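(* Let $\varphi_t(x)=(\varphi^1_t(x),\varphi^2_t(x))$, $t\ge0$, $x=(x_1,x_2)\in\mathbb{R}^2_+$, be the reflecting flow in the half-plane solving $$d\varphi_t(x)=A\varphi_t(x)\,dt+dw(t)+n\,L(dt,x),\quad \varphi_0(x)=x,\qquad A=\begin{pmatrix}1&1\\1&1\end{pmatrix}.$$ Then for any $t>0$ $$P\Bigl(\text{the derivative }\frac{\partial\varphi^1_t(\cdot)}{\partial x_1}\text{ exists at all points of some non-empty open subset of }\{x\in\mathbb{R}^2_+:\sigma(x)<t\}\Bigr)=0 .$$
   Context: $\mathbb{R}^2_+=\mathbb{R}\times[0,\infty)$, $\partial\mathbb{R}^2_+=\mathbb{R}\times\{0\}$, $n=(0,1)$, and $w$ is a Wiener process in $\mathbb{R}^2$. The solution of the reflected equation satisfies (in integral form) the equation with $\varphi_t(x)\in\mathbb{R}^2_+$, where $L(t,x)$ is continuous and non-decreasing in $t$, $L(0,x)=0$, and $\int_0^t\mathbf{1}_{\varphi_s(x)\in\partial\mathbb{R}^2_+}L(ds,x)=L(t,x)$ for all $t\ge0$. For every $\omega$ the solution exists, is unique, and is continuous in $(t,x)$. $\sigma(x)=\inf\{t\ge0:\varphi_t(x)\in\partial\mathbb{R}^2_+\}$. *)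

(* Defs.v *)
From HB Require Import structures.
From mathcomp Require Import all_boot all_order all_algebra.
From mathcomp Require Import all_classical all_reals all_analysis.
Set Implicit Arguments.
Unset Strict Implicit.
Unset Printing Implicit Defensive.
Import Order.TTheory GRing.Theory Num.Theory.
Import numFieldNormedType.Exports.
Local Open Scope classical_set_scope.
Local Open Scope ring_scope.

(* Points of the plane are column vectors; the coordinates x_1, x_2 of x are
   [x 0 0] and [x 1 0].  Time is a real number, and only its values in [0, +oo[
   are meaningful. *)

Section wiener.
Context {R : realType} {d : measure_display} {Omega : measurableType d}.
Variable P : probability Omega R.

(* Taking some of the [B i] equal to [setT] gives the product rule for every
   subfamily. *)
Definition mutually_independent (I : finType) (X : I -> Omega -> R) : Prop :=
  forall B : I -> set R, (forall i, measurable (B i)) ->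
    P (\bigcap_i (X i @^-1` B i)) = (\prod_i P (X i @^-1` B i))%E.

(* Standard Wiener process in the plane: its coordinates are independent
   scalar Wiener processes.  Starting at 0 and path continuity hold for every
   omega.  The independence clause is joint in the increments and in the two
   coordinates. *)
Definition wiener_process (w : R -> Omega -> 'cV[R]_2) : Prop :=
  [/\ forall t, 0 <= t -> forall i, measurable_fun setT (fun o => w t o i 0),
      forall o, w 0 o = 0,
      forall o, {within `[0, +oo[, continuous (fun t => w t o)},
      forall s t, 0 <= s -> s < t -> forall (i : 'I_2) (B : set R),
        measurable B ->
        P [set o | B (w t o i 0 - w s o i 0)] =
          normal_prob 0 (Num.sqrt (t - s)) B
    & forall (m : nat) (t : nat -> R), 0 <= t 0%N ->
        {homo t : j k / (j < k)%N >-> j < k} ->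
        mutually_independent (fun (ki : 'I_m * 'I_2) o =>
          w (t ki.1.+1) o ki.2 0 - w (t ki.1) o ki.2 0)].

End wiener.

Section reflected_equation.
Context {R : realType}.

Definition half_plane : set 'cV[R]_2 := [set x | 0 <= x 1 0].

Definition half_plane_boundary : set 'cV[R]_2 := [set x | x 1 0 = 0].

Definition inner_normal : 'cV[R]_2 := delta_mx 1 0.

(* [f] and [l] are the trajectory and the regulator started at [x] and driven
   by the path [w].  The regulator is set to 0 at negative times, so that it is
   a nondecreasing function on the whole line and L(ds) is its
   Lebesgue-Stieltjes measure. *)
Definition reflected_solution (A : 'M[R]_2) (w : R -> 'cV[R]_2) (x : 'cV[R]_2)
    (f : R -> 'cV[R]_2) (l : cumulative R R) : Prop :=
  [/\ {within `[0, +oo[, continuous f}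
        /\ (forall t, 0 <= t -> half_plane (f t)),
      continuous l,
      forall t, t <= 0 -> l t = 0,
      forall t, 0 <= t -> f t = x
        + \col_i (\int[lebesgue_measure]_(s in `[0, t]) (A *m f s) i 0)
        + w t + l t *: inner_normal
    & forall t, 0 <= t ->
        (\int[lebesgue_stieltjes_measure l]_(s in `[0%R, t])
          (\1_(f @^-1` half_plane_boundary) s)%:E = (l t)%:E)%E].

(* The value is +oo when the boundary is never reached. *)
Definition hitting_time (f : R -> 'cV[R]_2) : \bar R :=
  ereal_inf [set s%:E | s in [set s | 0 <= s /\ half_plane_boundary (f s)]].

(* If [x] is in the half-plane, so is every [x + h *: e_1]: the partial
   derivative only involves values of [g] in the half-plane, also when [x] is
   a boundary point. *)
Definition has_partial1 (g : 'cV[R]_2 -> R) (x : 'cV[R]_2) : Prop :=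
  derivable g x (delta_mx 0 0).

End reflected_equation.

(* Main.v *)
Require Import Defs.
From HB Require Import structures.
From mathcomp Require Import all_boot all_order all_algebra.
From mathcomp Require Import all_classical all_reals all_analysis.
From mathcomp Require Import measurable_realfun ring lra.
Set Implicit Arguments.
Unset Strict Implicit.
Unset Printing Implicit Defensive.
Import Order.TTheory GRing.Theory Num.Theory.
Import numFieldNormedType.Exports.
Local Open Scope classical_set_scope.
Local Open Scope ring_scope.

(** The derivative fails to exist at the starting points whose trajectory
    touches the boundary for the first time without being reflected. Start at
    such a point x and let s be the touching time. The trajectory started at
    x + h e_1 misses the boundary near s, whereas the one started at x - h e_1
    is pushed back by the reflection, which destroys its vertical difference
    with the trajectory of x. The right and left difference quotients thus
    separate right after s, by an amount proportional to h, and the cooperative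
    drift keeps them apart forever.

    Everything is deterministic except for one property of the driving path:
    almost surely, the second coordinate w^2 satisfies no bound
    w^2(v) - w^2(u) <= C (v - u) on any interval ([one_sided_rough]). For fixed
    endpoints and fixed C, such a bound makes n independent increments over
    intervals of length h all at most C h; once h is small, each of them is so
    with probability at most 1 - q, for a constant q > 0 independent of h
    ([wiener_one_sided_rough_ae]).

    Pathwise, write J(s) for the integral over [0, s] of phi^1 + phi^2. Then
    phi^1 = x_1 + J + w^1, phi^2 = x_2 + J + w^2 + L and
    J' = 2 J + x_1 + x_2 + w^1 + w^2 + L, so that J is a C^1 function although
    the trajectory is not, and trajectories are compared by scalar linear
    differential inequalities.

    Existence of a touching point ([touching_translate]). Take a starting point
    with x_2 > 0 in the open set, and let sg be the hitting time of its
    trajectory F = phi^2. Before sg, the unreflected trajectory started at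
    x - delta e_1 has second coordinate F - delta c, where
    c(s) = (e^(2 s) - 1) / 2 is an entry of exp (s A). If c / F were
    nondecreasing on an interval just before sg, then w^2 would satisfy a
    one-sided Lipschitz bound there; hence c / F takes a larger value at some u
    than at some later v, and its maximum over [0, v] is attained at some
    s < v. With delta = F(s) / c(s), the translated trajectory is nonnegative
    on [0, v] without any reflection, and vanishes at s. Since delta is small,
    the translated starting point is still in the open set.

    Separation ([drift_second_difference]). For such a trajectory and the two
    trajectories started at distance h on either side, the second differences
    E^1 = u := J_+ + J_- - 2 J and E^2 = u + q, with q = L_+ + L_- - 2 L,
    satisfy u' = E^1 + E^2. At time s, E^2 >= c(s) h because phi^2_s(x) = 0; on
    [s, v], where L vanishes, E^2 does not decrease and u gains at least
    c(s) (v - s) h. Afterwards u keeps increasing: at a first time where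
    u' <= 0, E^2 would be negative, since u > 0; but ever since the last time
    at which E^2 was nonnegative, phi^2(x) > 0, so that L is constant and E^2
    increases at least as much as u, a contradiction. So the second difference
    of phi^1_t at x is at least c(s) (v - s) h for every h > 0, which forbids a
    partial derivative ([second_difference_not_derivable]). *)

(** * First exit times and linear differential inequalities *)

Lemma first_le0 (R : realType) (g : R -> R) (a b : R) :
  continuous g -> a <= b -> 0 < g a -> g b <= 0 ->
  exists r, [/\ a < r, r <= b, g r <= 0 & forall s, a <= s -> s < r -> 0 < g s].
Proof.
move=> cg ab ga gb.
pose S := `[a, b] `&` [set s | g s <= 0].
have Sb : S b by split => //=; rewrite in_itv/= ab lexx.
have cS : compact S.
  apply: compact_closedI; first exact: segment_compact.
  apply: (@preimage_closed _ _ g [set y : R | y <= 0]); last exact: closed_le.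
  by move=> x _; exact: cg.
have cid : {within S, continuous (@id R)}.
  by apply: continuous_subspaceT => x; exact: cvg_id.
have [r rS rmin] := @compact_EVT_min _ _ id S (ex_intro _ b Sb) cS cid.
move: rS; rewrite inE => -[/=]; rewrite in_itv/= => /andP[ar rb] gr.
exists r; split => //.
  rewrite lt_neqAle ar andbT; apply/eqP => arE.
  by move: ga; rewrite arE ltNge gr.
move=> s as_ sr; rewrite ltNge; apply/negP => gs.
have : r <= s.
  apply: rmin; rewrite inE; split => //=.
  by rewrite in_itv/= as_ (ltW (lt_le_trans sr rb)).
by rewrite leNgt sr.
Qed.

Lemma last_ge0 (R : realType) (f : R -> R) (a b : R) :
  continuous f -> a <= b -> 0 <= f a -> f b < 0 ->
  exists r, [/\ a <= r, r < b, 0 <= f r & forall s, r < s -> s <= b -> f s < 0].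
Proof.
move=> cf ab fa fb.
have cg : continuous (fun s => - f (- s)).
  move=> x; apply: cvgN; apply: (continuous_comp (@oppr_continuous _ R^o x)).
  exact: cf.
have [|||r [br ra fr pos]] := @first_le0 _ _ (- b) (- a) cg.
- by rewrite lerN2.
- by rewrite opprK oppr_gt0.
- by rewrite opprK oppr_le0.
exists (- r); split; rewrite 1?lerNr 1?ltrNl//.
  by rewrite -oppr_le0.
move=> s rs sb; rewrite -oppr_gt0 -{1}(opprK s); apply: pos.
  by rewrite lerN2.
by rewrite ltrNl.
Qed.

Lemma derive_ge0_le (R : realType) (u du : R -> R) (a b x y : R) :
  continuous u ->
  (forall s, a < s -> s < b -> is_derive s 1 u (du s)) ->
  (forall s, a < s -> s < b -> 0 <= du s) ->
  a <= x -> x <= y -> y <= b -> u x <= u y.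
Proof.
move=> cu d1 d0 ax xy yb.
apply: (@ger0_derive1_le_cc _ u a b) => //.
- move=> s; rewrite in_itv/= => /andP[as_ sb].
  exact: (@ex_derive _ _ _ _ _ _ _ (d1 _ as_ sb)).
- move=> s; rewrite in_itv/= => /andP[as_ sb]; rewrite derive1E.
  by rewrite (@derive_val _ _ _ _ _ _ _ (d1 _ as_ sb)) d0.
- exact: continuous_subspaceT.
- by rewrite in_itv/= ax (le_trans xy).
- by rewrite in_itv/= yb (le_trans ax).
Qed.

(** Gronwall's inequality: a solution of u' >= k u with u(a) >= 0 is
    nonnegative. *)
Lemma linear_ode_ge0 (R : realType) (k : R) (u p : R -> R) (a b x : R) :
  continuous u -> 0 <= u a ->
  (forall s, a < s -> s < b -> is_derive s 1 u (k * u s + p s)) ->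
  (forall s, a < s -> s < b -> 0 <= p s) ->
  a <= x -> x <= b -> 0 <= u x.
Proof.
move=> cu ua du p0 ax xb.
pose v := fun s => u s * expR (- k * s).
have dv s : a < s -> s < b -> is_derive s 1 v (p s * expR (- k * s)).
  move=> as_ sb; have dus := du _ as_ sb; rewrite /v.
  apply: is_derive_eq; rewrite /GRing.scale/=; ring.
have cv : continuous v.
  move=> s; apply: cvgM; first exact: cu.
  apply: continuous_comp; last exact: continuous_expR.
  by apply: cvgM; [exact: cvg_cst|exact: cvg_id].
have : v a <= v x.
  apply: (@derive_ge0_le _ v _ a b _ _ cv dv) => // s as_ sb.
  by rewrite mulr_ge0 ?expR_ge0 ?p0.
move=> vax; have : 0 <= v x by apply: le_trans vax; rewrite mulr_ge0 ?expR_ge0.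
by rewrite /v pmulr_lge0 ?expR_gt0.
Qed.

(** * Scalar form of the reflected equation *)

(** The data of a solution started at (x1, x2) and driven by (w1, w2): [F] is
    its second coordinate, [J] is the integral over [0, s] of the sum of its
    coordinates and [l] its regulator.  The first coordinate is x1 + J + w1, so
    the derivative of [J] below is the sum of the two coordinates.  The
    functions are continuous on the whole line, but the equations only concern
    nonnegative times.  [reg_flat] says that the regulator is constant while the
    second coordinate is positive. *)
Record reflected_path {R : realType} (w1 w2 : R -> R) (x1 x2 : R)
    (F J l : R -> R) : Prop := ReflectedPath {
  path_cont : continuous F;
  drift_cont : continuous J;
  reg_cont : continuous l;
  path_ge0 : forall s : R, 0 <= s -> 0 <= F s;
  drift0 : J 0 = 0;
  reg0 : l 0 = 0;
  reg_homo : {homo l : r s / (r <= s)%R};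
  pathE : forall s : R, 0 <= s -> F s = x2 + J s + w2 s + l s;
  drift_derive : forall s : R, 0 < s ->
    is_derive s 1 J (2 * J s + (x1 + x2 + w1 s + w2 s) + l s);
  reg_flat : forall r v : R, 0 <= r -> r <= v ->
    (forall s : R, r < s -> s <= v -> 0 < F s) -> l v = l r }.

(** The (2,1) entry of exp (s A), for A the 2 x 2 matrix of ones: the vertical
    displacement at time s caused by a unit horizontal displacement of the
    starting point, in the absence of reflection. *)
Definition exp21 {R : realType} (s : R) : R := (expR (2 * s) - 1) / 2.

Section paths.
Context {R : realType}.
Implicit Types (w F J l : R -> R) (x a b r s t v h : R).

Lemma is_derive_exp21 s : is_derive s 1 (@exp21 R) (2 * exp21 s + 1).
Proof.
rewrite /exp21; apply: is_derive_eq; rewrite /GRing.scale/=; lra.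
Qed.

Lemma continuous_exp21 : continuous (@exp21 R).
Proof.
move=> s; apply: differentiable_continuous; apply/derivable1_diffP.
exact: (@ex_derive _ _ _ _ _ _ _ (is_derive_exp21 s)).
Qed.

Lemma exp21_0 : exp21 0 = 0 :> R.
Proof. by rewrite /exp21 mulr0 expR0 subrr mul0r. Qed.

Lemma exp21_gt0 s : 0 < s -> 0 < exp21 s.
Proof.
move=> s0; rewrite /exp21 divr_gt0// subr_gt0 expR_gt1; lra.
Qed.

Lemma reg_ge0 w1 w2 x1 x2 F J l s :
  reflected_path w1 w2 x1 x2 F J l -> 0 <= s -> 0 <= l s.
Proof. by move=> p s0; rewrite -(reg0 p) (reg_homo p). Qed.

(** Moving the starting point horizontally by h displaces the trajectory by at
    least h exp (s A) e_1 as long as the original one is not reflected: the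
    reflection of the translated trajectory can only increase [J].  The sign of
    h is arbitrary. *)
Lemma drift_translate_ge w1 w2 x1 x2 h Fy Jy ly Fz Jz lz v :
  reflected_path w1 w2 x1 x2 Fy Jy ly ->
  reflected_path w1 w2 (x1 + h) x2 Fz Jz lz ->
  ly v = 0 ->
  forall s, 0 <= s -> s <= v -> Jy s + h * exp21 s <= Jz s.
Proof.
move=> py pz lv s s0 sv; rewrite -subr_ge0.
have ly0 r : 0 <= r -> r <= v -> ly r = 0.
  move=> r0 rv; apply/eqP; rewrite eq_le (reg_ge0 py)// andbT -lv.
  exact: (reg_homo py).
pose k r := Jz r - (Jy r + h * exp21 r).
have ck : continuous k.
  move=> r; apply: cvgB; first exact: (drift_cont pz).
  apply: cvgD; first exact: (drift_cont py).
  by apply: cvgM; [exact: cvg_cst|exact: continuous_exp21].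
apply: (@linear_ode_ge0 _ 2 k lz 0 v _ ck) => //.
- by rewrite /k (drift0 py) (drift0 pz) exp21_0 mulr0 addr0 subrr.
- move=> r r0 rv; have d1 := drift_derive pz r0; have d2 := drift_derive py r0.
  have d3 := is_derive_exp21 r.
  rewrite /k; apply: is_derive_eq.
  by rewrite /GRing.scale/= (ly0 r (ltW r0) (ltW rv)); ring.
- by move=> r r0 rv; rewrite (reg_ge0 pz)// ltW.
Qed.

Lemma drift_translate_eq w1 w2 x1 x2 h Fy Jy ly Fz Jz lz v :
  reflected_path w1 w2 x1 x2 Fy Jy ly ->
  reflected_path w1 w2 (x1 + h) x2 Fz Jz lz ->
  ly v = 0 -> lz v = 0 ->
  forall s, 0 <= s -> s <= v -> Jz s = Jy s + h * exp21 s.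
Proof.
move=> py pz lv lzv s s0 sv; apply/eqP; rewrite eq_le.
rewrite (drift_translate_ge py pz lv)// andbT.
have py' : reflected_path w1 w2 (x1 + h + - h) x2 Fy Jy ly by rewrite addrK.
by have := drift_translate_ge pz py' lzv s0 sv; lra.
Qed.

(** If the translate of an unreflected trajectory would stay nonnegative without
    reflection, then it is not reflected. *)
Lemma reg_eq0 w1 w2 x1 x2 h Fy Jy ly Fz Jz lz v :
  reflected_path w1 w2 x1 x2 Fy Jy ly ->
  reflected_path w1 w2 (x1 + h) x2 Fz Jz lz ->
  0 <= v -> ly v = 0 ->
  (forall s, 0 <= s -> s <= v -> 0 <= Fy s + h * exp21 s) ->
  lz v = 0.
Proof.
move=> py pz v0 lv pos.
apply/eqP; rewrite eq_le (reg_ge0 pz)// andbT leNgt; apply/negP => lzv.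
(* look at the last time at which lz vanishes: afterwards Fz is positive *)
have cl : continuous (fun s => - lz s).
  by move=> s; apply: cvgN; exact: (reg_cont pz).
have [||r [r0 rv lr low]] := @last_ge0 _ _ 0 v cl v0.
- by rewrite (reg0 pz) oppr0.
- by rewrite oppr_lt0.
suff : lz v = lz r by move: lr; lra.
apply: (reg_flat pz) => //; first exact: ltW.
move=> s rs sv; have s0 : 0 <= s by lra.
have := low s rs sv; rewrite oppr_lt0 => ls.
have := drift_translate_ge py pz lv s0 sv.
have := pos s s0 sv.
rewrite (pathE pz s0) (pathE py s0).
have lys : ly s = 0.
  apply/eqP; rewrite eq_le (reg_ge0 py)// andbT -lv.
  exact: (reg_homo py).
lra.
Qed.

(** A trajectory touching the boundary at time s without being reflected before
    v > s: the second difference of the drift, for the starting points at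
    distance h on either side, is at least a positive constant times h at all
    times after v, and the constant does not depend on h. *)
Lemma drift_second_difference w1 w2 x1 x2 h F J l Fp Jp lp Fm Jm lm s v t :
  reflected_path w1 w2 x1 x2 F J l ->
  reflected_path w1 w2 (x1 + h) x2 Fp Jp lp ->
  reflected_path w1 w2 (x1 - h) x2 Fm Jm lm ->
  0 < h -> 0 < s -> s < v -> v <= t -> F s = 0 -> l v = 0 ->
  exp21 s * (v - s) * h <= Jp t + Jm t - 2 * J t.
Proof.
move=> p pp pm h0 s0 sv vt Fs lv.
have lle r : 0 <= r -> r <= v -> l r = 0.
  move=> r0 rv; apply/eqP; rewrite eq_le (reg_ge0 p)// andbT -lv.
  exact: (reg_homo p).
(* u and u + q are the second differences of the two coordinates *)
pose u r := Jp r + Jm r - 2 * J r.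
pose q r := lp r + lm r - 2 * l r.
have cu : continuous u.
  move=> r; apply: cvgB; last first.
    by apply: cvgM; [exact: cvg_cst|exact: (drift_cont p)].
  by apply: cvgD; [exact: (drift_cont pp)|exact: (drift_cont pm)].
have cq : continuous q.
  move=> r; apply: cvgB; last first.
    by apply: cvgM; [exact: cvg_cst|exact: (reg_cont p)].
  by apply: cvgD; [exact: (reg_cont pp)|exact: (reg_cont pm)].
have du r : 0 < r -> is_derive r 1 u (2 * u r + q r).
  move=> r0; have d1 := drift_derive pp r0; have d2 := drift_derive pm r0.
  have d3 := drift_derive p r0; rewrite /u /q.
  apply: is_derive_eq; rewrite /GRing.scale/=; ring.
have FE r : 0 <= r -> u r + q r = Fp r + Fm r - 2 * F r.
  by move=> r0; rewrite (pathE p r0) (pathE pp r0) (pathE pm r0) /u /q; ring.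
(* up to time v, the regulator of the middle trajectory vanishes *)
have qE r : 0 <= r -> r <= v -> q r = lp r + lm r.
  by move=> r0 rv; rewrite /q lle//; ring.
have q_ge0 r : 0 <= r -> r <= v -> 0 <= q r.
  by move=> r0 rv; rewrite qE// addr_ge0 ?(reg_ge0 pp) ?(reg_ge0 pm).
have u_ge0 r : 0 <= r -> r <= v -> 0 <= u r.
  move=> r0 rv; apply: (@linear_ode_ge0 _ 2 u q 0 v _ cu) => //.
  - by rewrite /u (drift0 p) (drift0 pp) (drift0 pm); lra.
  - by move=> z z0 _; exact: du.
  - by move=> z z0 zv; apply: q_ge0; exact: ltW.
have u_homo y z : 0 <= y -> y <= z -> z <= v -> u y <= u z.
  move=> y0 yz zv.
  apply: (@derive_ge0_le _ u (fun r => 2 * u r + q r) 0 v y z cu) => //.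
    by move=> r r0 _; exact: du.
  by move=> r r0 rv; rewrite addr_ge0 ?mulr_ge0 ?q_ge0 ?u_ge0// ltW.
have Es : exp21 s * h <= u s + q s.
  rewrite (FE s (ltW s0)) Fs mulr0 subr0.
  have := path_ge0 pm (ltW s0).
  have := drift_translate_ge p pp lv (ltW s0) (ltW sv).
  rewrite (pathE pp (ltW s0)).
  have := reg_ge0 pp (ltW s0).
  move: Fs; rewrite (pathE p (ltW s0)) (lle s (ltW s0) (ltW sv)); lra.
have Er r : s <= r -> r <= v -> exp21 s * h <= u r + q r.
  move=> sr rv; apply: (le_trans Es); apply: lerD.
    by apply: u_homo => //; exact: ltW.
  rewrite !qE//; [|lra..].
  by apply: lerD; [exact: (reg_homo pp)|exact: (reg_homo pm)].
have uv : exp21 s * (v - s) * h <= u v.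
  pose f r := u r - exp21 s * h * r.
  have cf : continuous f.
    move=> r; apply: cvgB; first exact: cu.
    by apply: cvgM; [exact: cvg_cst|exact: cvg_id].
  have := @derive_ge0_le _ f (fun r => 2 * u r + q r - exp21 s * h) s v s v cf.
  have -> : (f s <= f v) = (u s + exp21 s * (v - s) * h <= u v).
    rewrite /f lerBrDr; congr (_ <= _); ring.
  have := u_ge0 s (ltW s0) (ltW sv) => us H.
  suff : u s + exp21 s * (v - s) * h <= u v by lra.
  apply: H; rewrite ?lexx ?(ltW sv)// => r sr rv.
    have r0 : 0 < r by lra.
    have dr := du r r0.
    by rewrite /f; apply: is_derive_eq; rewrite /GRing.scale/=; ring.
  have := Er r (ltW sr) (ltW rv).
  have : 0 <= r by lra.
  by move=> /u_ge0 /(_ (ltW rv)); lra.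
have es : 0 < exp21 s * h by rewrite mulr_gt0// exp21_gt0.
have uv0 : 0 < u v.
  apply: lt_le_trans uv; rewrite mulrAC mulr_gt0//; lra.
(* after time v, u increases: consider the first time T with u'(T) <= 0 *)
pose du' r := 2 * u r + q r.
have cdu' : continuous du'.
  move=> r; apply: cvgD; last exact: cq.
  by apply: cvgM; [exact: cvg_cst|exact: cu].
have v0 : 0 < v by lra.
have du'v : 0 < du' v.
  by rewrite /du'; have := Er v (ltW sv) (lexx v); lra.
have u_homo2 y : v <= y -> (forall r, v <= r -> r < y -> 0 < du' r) ->
    forall z, v <= z -> z <= y -> u z <= u y.
  move=> vy pos z vz zy.
  apply: (@derive_ge0_le _ u du' v y z y cu) => //.
    by move=> r vr _; apply: du; lra.
  by move=> r vr ry; apply/ltW/pos => //; exact: ltW.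
have pos r : v <= r -> 0 < du' r.
  move=> vr; rewrite ltNge; apply/negP => dr.
  have [T [vT Tr dT posT]] := first_le0 cdu' vr du'v dr.
  have uT := u_homo2 T (ltW vT) posT.
  have ET : 0 <= u T + q T.
    rewrite leNgt; apply/negP => ET.
    have cuq : continuous (fun r => u r + q r).
      by move=> z; apply: cvgD; [exact: cu|exact: cq].
    have [|z [vz zT Ez low]] := last_ge0 cuq (ltW vT) _ ET.
      have := Er v (ltW sv) (lexx v); lra.
    (* on ]z, T] the middle trajectory is positive, since u + q < 0 *)
    suff lz : l T = l z.
      have := uT z vz (ltW zT).
      have := reg_homo pp (ltW zT).
      have := reg_homo pm (ltW zT).
      by move: Ez ET; rewrite /q lz; lra.
    apply: (reg_flat p); [lra|exact: ltW|].
    move=> y zy yT; have y0 : 0 <= y by lra.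
    have := low y zy yT; rewrite FE//.
    by have := path_ge0 pp y0; have := path_ge0 pm y0; lra.
  by move: dT; rewrite /du'; have := uT v (lexx v) (ltW vT); lra.
have := u_homo2 t vt (fun r vr _ => pos r vr) v (lexx v) vt.
rewrite -/(u t); lra.
Qed.
End paths.

(** * Trajectories touching the boundary *)

(** On no nondegenerate interval of nonnegative times does w satisfy an upper
    bound w v - w u <= C (v - u).  A function which is, on some such interval,
    the sum of a nonincreasing function and a Lipschitz one does satisfy such a
    bound. *)
Definition one_sided_rough {R : realType} (w : R -> R) : Prop :=
  forall p q C : R, 0 <= p -> p < q ->
    exists u v, [/\ p <= u, u < v, v <= q & C * (v - u) < w v - w u].

Section touching.
Context {R : realType}.
Implicit Types (w F J l : R -> R) (x a b r s t v h : R).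

(** If the trajectory started at (x1, x2) reaches the boundary, then one started
    slightly to the left touches it at some time s without being reflected up to
    a later time v. *)
Lemma touching_translate w1 w2 x1 x2 F J l (eta T : R) :
  continuous w1 -> continuous w2 -> w2 0 = 0 -> one_sided_rough w2 ->
  reflected_path w1 w2 x1 x2 F J l ->
  0 < x2 -> 0 < eta -> 0 <= T -> F T <= 0 ->
  exists s v delta, [/\ 0 < s, s < v, v <= T, 0 <= delta <= eta &
    forall Fz Jz lz, reflected_path w1 w2 (x1 - delta) x2 Fz Jz lz ->
      Fz s = 0 /\ lz v = 0].
Proof.
move=> cw1 cw2 w20 rough p x20 eta0 T0 FT.
have cF := path_cont p.
have F0 : 0 < F 0 by rewrite (pathE p (lexx 0)) (drift0 p) (reg0 p) w20; lra.
have [sg [sg0 sgT Fsg Fpos]] := first_le0 cF T0 F0 FT.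
have l0 r : 0 <= r -> r < sg -> l r = 0.
  move=> r0 rsg; rewrite -(reg0 p); apply: (reg_flat p) => // s s0 sr.
  by apply: Fpos; [exact: ltW|exact: le_lt_trans rsg].
(* s1 is so close to the hitting time that F <= eta exp21 on [s1, sg[ *)
pose g r := F r - eta * exp21 r.
have cg : continuous g.
  move=> r; apply: cvgB; first exact: cF.
  by apply: cvgM; [exact: cvg_cst|exact: continuous_exp21].
have [||r1 [r10 r1sg _ glow]] := last_ge0 cg (ltW sg0).
- by rewrite /g exp21_0; lra.
- by rewrite /g; have := mulr_gt0 eta0 (exp21_gt0 sg0); lra.
pose s1 := (r1 + sg) / 2; pose s2 := (s1 + sg) / 2.
have s1r : r1 < s1 by rewrite /s1; lra.
have s10 : 0 < s1 by lra.
have s12 : s1 < s2 by rewrite /s2 /s1; lra.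
have s2sg : s2 < sg by rewrite /s2 /s1; lra.
have Feta r : s1 <= r -> r < sg -> F r <= eta * exp21 r.
  by move=> s1r' rsg; have := glow r; rewrite /g => H; have := H; lra.
(* the ratio exp21 / F is not nondecreasing on [s1, s2] *)
have [u [v [s1u uv vs2 muv]]] : exists u v, [/\ s1 <= u, u < v, v <= s2 &
    exp21 v * F u < exp21 u * F v].
  apply: contrapT => nuv.
  have mono u v : s1 <= u -> u < v -> v <= s2 ->
      exp21 u * F v <= exp21 v * F u.
    move=> s1u uv vs2; rewrite leNgt; apply/negP => H.
    by apply: nuv; exists u, v.
  (* otherwise w2 increases at most linearly on [s1, s2] *)
  pose dJ r := 2 * J r + (x1 + x2 + w1 r + w2 r) + l r.
  have cdJ : continuous dJ.
    move=> r; apply: cvgD; last exact: (reg_cont p).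
    apply: cvgD; first by apply: cvgM; [exact: cvg_cst|exact: (drift_cont p)].
    apply: cvgD; last exact: cw2.
    by apply: cvgD; [exact: cvg_cst|exact: cw1].
  have [c _ dJmin] := EVT_min (ltW s12) (continuous_subspaceT cdJ).
  pose K := 2 * exp21 sg + 1.
  have [u [v [s1u uv vs2 wuv]]] := rough s1 s2 (eta * K - dJ c) (ltW s10) s12.
  have Juv : J u - dJ c * u <= J v - dJ c * v.
    apply: (@derive_ge0_le _ (fun r => J r - dJ c * r)
      (fun r => dJ r - dJ c) s1 s2) => //; last exact: ltW.
    - move=> r; apply: cvgB; first exact: (drift_cont p).
      by apply: cvgM; [exact: cvg_cst|exact: cvg_id].
    - move=> r s1r' _; have r0 : 0 < r by lra.
      have d1 := drift_derive p r0.
      by apply: is_derive_eq; rewrite /GRing.scale/= /dJ; ring.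
    - move=> r s1r' rs2; rewrite subr_ge0; apply: dJmin.
      by rewrite in_itv/= !ltW.
  have e_homo (y z : R) : 0 <= y -> y <= z -> exp21 y <= exp21 z.
    move=> y0 yz; rewrite /exp21 ler_pM2r; last lra.
    by rewrite lerB// ler_expR; lra.
  have euv : K * u - exp21 u <= K * v - exp21 v.
    apply: (@derive_ge0_le _ (fun r => K * r - exp21 r)
      (fun r => K - (2 * exp21 r + 1)) s1 s2) => //; last exact: ltW.
    - move=> r; apply: cvgB; last exact: continuous_exp21.
      by apply: cvgM; [exact: cvg_cst|exact: cvg_id].
    - move=> r s1r' _; have d1 := is_derive_exp21 r.
      by apply: is_derive_eq; rewrite /GRing.scale/=; ring.
    - move=> r s1r' rs2; rewrite /K.
      have r0 : 0 <= r by lra.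
      have rsg : r <= sg by lra.
      by have := e_homo r sg r0 rsg; lra.
  have eu : 0 < exp21 u by apply: exp21_gt0; lra.
  have FvFu : F v - F u <= eta * (exp21 v - exp21 u).
    have m1 := mono u v s1u uv vs2.
    have usg : u < sg by lra.
    have m2 := Feta u s1u usg.
    rewrite -(ler_pM2l eu).
    have u0 : 0 <= u by lra.
    have : (exp21 v - exp21 u) * F u <= (exp21 v - exp21 u) * (eta * exp21 u).
      by apply: ler_wpM2l => //; rewrite subr_ge0 e_homo// ltW.
    nra.
  have u0 : 0 <= u by lra.
  have v0 : 0 <= v by lra.
  have usg : u < sg by lra.
  have vsg : v < sg by lra.
  move: FvFu; rewrite (pathE p u0) (pathE p v0) l0// l0//.
  have : eta * (exp21 v - exp21 u) <= eta * (K * (v - u)).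
    by rewrite ler_pM2l//; lra.
  by lra.
have v0 : 0 < v by lra.
have vsg : v < sg by lra.
pose m r := exp21 r / F r.
have cm : {within `[0, v], continuous m}.
  apply: continuous_subspace_itv => r; rewrite in_itv/= => /andP[r0 rv].
  apply: cvgM; first exact: continuous_exp21.
  apply: cvgV; last exact: cF.
  by rewrite gt_eqF// Fpos//; lra.
(* s maximizes exp21 / F, and delta is the inverse of the maximum *)
have [s] := EVT_max (ltW v0) cm.
rewrite in_itv/= => /andP[s0 sv] smax.
have Fs : 0 < F s by apply: Fpos => //; lra.
have smax' r : 0 <= r -> r <= v -> exp21 r * F s <= exp21 s * F r.
  move=> r0 rv; have := smax r; rewrite in_itv/= r0 rv => /(_ isT).
  have Fr : 0 < F r by apply: Fpos => //; lra.
  by rewrite /m ler_pdivrMr// mulrAC ler_pdivlMr.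
have u0 : 0 < u by lra.
have eu := exp21_gt0 u0.
have Fu : 0 < F u by apply: Fpos; lra.
have Fv : 0 < F v by apply: Fpos; lra.
have su := smax' u (ltW u0) (ltW uv).
have s_gt0 : 0 < s.
  rewrite lt_neqAle s0 andbT; apply/eqP => s0E.
  move: su; rewrite -s0E exp21_0 mul0r leNgt mulr_gt0// F0//.
have es := exp21_gt0 s_gt0.
have sltv : s < v.
  rewrite lt_neqAle sv andbT; apply/eqP => svE.
  by move: su; rewrite svE leNgt muv.
have cross r : 0 <= r -> r <= v -> F s / exp21 s * exp21 r <= F r.
  move=> r0 rv; have H := smax' r r0 rv.
  by rewrite mulrAC ler_pdivrMr//; lra.
exists s, v, (F s / exp21 s); split => //; first lra.
  apply/andP; split; first by rewrite divr_ge0 ?ltW.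
  have usg : u < sg by lra.
  have Fue := Feta u s1u usg.
  by rewrite -(ler_pM2r eu) (le_trans (cross u (ltW u0) (ltW uv))).
move=> Fz Jz lz pz.
have lv : l v = 0 by apply: l0 => //; exact: ltW.
have lzv : lz v = 0.
  apply: (reg_eq0 p pz (ltW v0) lv) => r r0 rv.
  by rewrite mulNr subr_ge0 cross.
split=> //.
have lzs : lz s = 0.
  by apply/eqP; rewrite eq_le (reg_ge0 pz s0) andbT -lzv (reg_homo pz).
rewrite (pathE pz s0) (drift_translate_eq p pz lv lzv s0 sv) lzs.
rewrite mulNr divfK ?gt_eqF// (pathE p s0) l0//; last lra.
ring.
Qed.

End touching.

(** * From reflected solutions to their scalar form *)

Section path_of_solution.
Context {R : realType}.

Lemma continuous_max0 (U : topologicalType) (f : R -> U) :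
  {within `[0, +oo[, continuous f} -> continuous (fun s : R => f (Num.max 0 s)).
Proof.
move=> /subspace_continuousP cf x.
have x0 : `[0, +oo[%classic (Num.max 0 x) by rewrite /= in_itv/= le_max lexx.
have cm : continuous (fun s : R => Num.max 0 s).
  by move=> y; apply: continuous_max; [exact: cvg_cst|exact: cvg_id].
apply: cvg_comp; last exact: cf x0.
move=> P wP.
have H : nbhs (Num.max 0 x) (fun y => `[0, +oo[%classic y -> P y) := wP.
have H' : \forall z \near x, `[0, +oo[%classic (Num.max 0 z) ->
    P (Num.max 0 z) := cm x _ H.
apply: filterS H' => z /=; apply.
by rewrite in_itv/= le_max lexx.
Qed.

(** Paths are frozen at their initial value at negative times, which makes them
    continuous on the whole line. *)
Lemma reflected_solution_path (w : R -> 'cV[R]_2) (x : 'cV[R]_2)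
    (f : R -> 'cV[R]_2) (l : cumulative R R) :
  {within `[0, +oo[, continuous w} ->
  reflected_solution (const_mx 1) w x f l ->
  exists2 J, reflected_path (fun s : R => w (Num.max 0 s) 0 0)
      (fun s : R => w (Num.max 0 s) 1 0) (x 0 0) (x 1 0)
      (fun s : R => f (Num.max 0 s) 1 0) J l &
    forall s, 0 <= s -> f s 0 0 = x 0 0 + J s + w s 0 0.
Proof.
move=> cw [[cf fge] cl lneg fE supp].
have maxE (s : R) : 0 <= s -> Num.max 0 s = s by move=> s0; apply: max_r.
have max0 (s : R) : 0 <= Num.max 0 s by rewrite le_max lexx.
have cfm := continuous_max0 cf.
have cwm := continuous_max0 cw.
have cF i : continuous (fun s : R => f (Num.max 0 s) i 0).
  move=> s; apply: (@continuous_comp _ _ _ (fun s : R => f (Num.max 0 s))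
    (fun M : 'cV[R]_2 => M i 0)); first exact: cfm.
  exact: coord_continuous.
have cW i : continuous (fun s : R => w (Num.max 0 s) i 0).
  move=> s; apply: (@continuous_comp _ _ _ (fun s : R => w (Num.max 0 s))
    (fun M : 'cV[R]_2 => M i 0)); first exact: cwm.
  exact: coord_continuous.
pose G (s : R) := f (Num.max 0 s) 0 0 + f (Num.max 0 s) 1 0.
have cG : continuous G by move=> s; apply: cvgD; exact: cF.
pose J s := (\int[lebesgue_measure]_(r in `[0, s]) G r)%R.
have intE (i : 'I_2) s : (\int[lebesgue_measure]_(r in `[0, s])
    ((const_mx 1 : 'M[R]_2) *m f r) i 0)%R = J s.
  apply: eq_Rintegral => r; rewrite inE/= in_itv/= => /andP[r0 _].
  rewrite !mxE !big_ord_recl big_ord0 !mxE /G maxE// !mul1r addr0.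
  by congr (_ + f r _ _); apply: val_inj.
have f1E s : 0 <= s -> f s 0 0 = x 0 0 + J s + w s 0 0.
  by move=> s0; rewrite {1}fE// !mxE intE/= mulr0 addr0.
have f2E s : 0 <= s -> f s 1 0 = x 1 0 + J s + w s 1 0 + l s.
  by move=> s0; rewrite {1}fE// !mxE intE/= mulr1.
have Jneg s : s <= 0 -> J s = 0.
  rewrite le_eqVlt => /predU1P[->|s0]; rewrite /J.
    by rewrite set_itv1 Rintegral_set1.
  by rewrite set_itv_ge ?Rintegral_set0// bnd_simp -ltNge.
have JE : J = (fun s : R => f (Num.max 0 s) 0 0 - x 0 0 - w (Num.max 0 s) 0 0).
  apply/funext => s; have := f1E _ (max0 s).
  have [s0|s0] := leP 0 s; first by move=> ->; ring.
  by rewrite (Jneg s (ltW s0)) Jneg// => ->; ring.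
exists J => //; split.
- exact: cF.
- rewrite JE => s; apply: cvgB; last exact: cW.
  by apply: cvgB; [exact: cF|exact: cvg_cst].
- exact: cl.
- by move=> s s0; exact: fge.
- by rewrite Jneg.
- by rewrite lneg.
- exact: cumulative_is_nondecreasing.
- by move=> s s0; rewrite maxE// f2E.
- move=> s s0.
  have iG : lebesgue_measure.-integrable `[0, s + 1] (EFin \o G).
    apply: continuous_compact_integrable; first exact: segment_compact.
    exact: continuous_subspaceT.
  have ss1 : s < s + 1 by rewrite ltrDl.
  have [dJ dJE] := continuous_FTC1_closed ss1 iG s0 (cG s).
  have := derivableP dJ; rewrite -derive1E dJE => dJs.
  apply: (is_derive_eq dJs).
  by rewrite /G maxE ?ltW// f1E ?f2E ?ltW//; ring.
- (* dl is carried by the zero set Z of F, which meets [0, v] inside [0, r] *)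
  move=> r v r0 rv pos; have v0 := le_trans r0 rv.
  apply/eqP; rewrite eq_le; apply/andP; split; last first.
    exact: cumulative_is_nondecreasing.
  pose mu : {measure set (measurableTypeR R) -> \bar R} :=
    lebesgue_stieltjes_measure l.
  pose Z := [set s : R | f (Num.max 0 s) 1 0 = 0].
  have mZ : measurable (Z : set (measurableTypeR R)).
    apply: closed_measurable.
    apply: (@preimage_closed _ _ (fun s : R => f (Num.max 0 s) 1 0) [set 0]).
      by move=> s _; exact: cF.
    exact: closed_eq.
  have : mu (Z `&` `[0, v]) = (l v)%:E.
    rewrite -(supp v v0) -(integral_indic mu (measurable_itv `[0, v]) mZ).
    apply: eq_integral => s; rewrite inE/= in_itv/= => /andP[s0 _].
    by rewrite !indicE; congr (nat_of_bool _)%:R%:E;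
      apply/idP/idP; rewrite !inE /Z/= maxE.
  move=> lvE; rewrite -lee_fin -lvE.
  (* ]-1, r] covers [0, r], and l vanishes at -1 *)
  have : lebesgue_stieltjes_measure l `]-1, r]%classic = (l r)%:E.
    rewrite /lebesgue_stieltjes_measure /measure_extension/=.
    rewrite measurable_mu_extE/= ?wlength_itv_bnd//; last exact: is_ocitv.
      by rewrite (_ : l (-1) = 0) ?subr0//; apply: lneg; lra.
    lra.
  move=> <-; apply: (@le_measure _ _ _ mu); rewrite ?inE//.
  - by apply: measurableI.
  - move=> s [Zs]; rewrite /= !in_itv/= => /andP[s0 sv].
    rewrite (lt_le_trans _ s0) ?ltrN10//= leNgt; apply/negP => rs.
    by have := pos s rs sv; rewrite Zs ltxx.
Qed.

End path_of_solution.

(** * Roughness of Wiener paths *)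

Section wiener_rough.
Context {R : realType}.

(** A lower bound for the probability that a centered Gaussian variable lies
    between one and two standard deviations. *)
Definition normal_tail : R := expR (- 2) / Num.sqrt (pi *+ 2).

Lemma normal_tail_gt0 : 0 < normal_tail.
Proof. by rewrite divr_gt0 ?expR_gt0// sqrtr_gt0 pmulrn_lgt0// pi_gt0. Qed.

Lemma normal_prob_window (s : R) : 0 < s ->
  ((normal_tail)%:E <= normal_prob 0 s `]s, (2 * s)%R])%E.
Proof.
move=> s0.
(* the density is at least normal_tail / s on ]s, 2 s] *)
have -> : normal_tail%:E =
    (\int[lebesgue_measure]_(x in `]s, (2 * s)%R]) (normal_tail / s)%:E)%E.
  rewrite integral_cst//= lebesgue_measure_itv/= lte_fin.
  have -> : s < 2 * s by lra.
  rewrite -EFinB -EFinM; congr _%:E.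
  have -> : 2 * s - s = s by ring.
  by rewrite divfK// gt_eqF.
rewrite /normal_prob; apply: ge0_le_integral => //.
- by move=> x _; rewrite lee_fin divr_ge0 ?ltW// normal_tail_gt0.
- apply/measurable_EFinP; apply: measurable_funTS; exact: measurable_normal_pdf.
- move=> x; rewrite /= in_itv/= => /andP[sx x2s].
  rewrite lee_fin /normal_pdf gt_eqF// /normal_tail /normal_peak /normal_fun.
  rewrite subr0.
  have -> : Num.sqrt (s ^+ 2 * pi *+ 2) = s * Num.sqrt (pi *+ 2).
    by rewrite -mulrnAr sqrtrM ?sqr_ge0// sqrtr_sqr gtr0_norm.
  rewrite -mulrA -invfM [Num.sqrt _ * s]mulrC [leLHS]mulrC ler_pM2l; last first.
    by rewrite invr_gt0 mulr_gt0// sqrtr_gt0 pmulrn_lgt0// pi_gt0.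
  rewrite ler_expR mulNr lerN2 ler_pdivrMr; last first.
    by rewrite pmulrn_lgt0// exprn_gt0.
  by rewrite -mulr_natr; nra.
Qed.

Lemma normal_prob_le (s a : R) : 0 < s -> a <= s ->
  (normal_prob 0 s `]-oo, a] <= (1 - normal_tail)%:E)%E.
Proof.
move=> s0 as_.
pose B : set (measurableTypeR R) := `]s, (2 * s)%R]%classic.
have mB : measurable B by exact: measurable_itv.
apply: (@le_trans _ _ (normal_prob 0 s (~` B))).
  apply: (@le_measure _ _ _ (normal_prob (0:R) s)); rewrite ?inE//.
    exact: measurableC.
  move=> x; rewrite /B /= !in_itv/= => xa; apply/negP; rewrite negb_and -leNgt.
  by rewrite (le_trans xa as_).
rewrite (probability_setC (normal_prob (0:R) s) mB) EFinB.
by rewrite leeB// normal_prob_window.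
Qed.

Context {d : measure_display} {Omega : measurableType d}.
Context (P : probability Omega R) (w : R -> Omega -> 'cV[R]_2).
Context (wienerw : wiener_process P w).

(** The first n increments of the second coordinate, over consecutive intervals
    of length h starting at p, are all at most a. *)
Definition increments_le (p h a : R) (n : nat) : set Omega :=
  \bigcap_(k in [set k | (k < n)%N])
    [set o | w (p + k.+1%:R * h) o 1 0 - w (p + k%:R * h) o 1 0 <= a].

Lemma measurable_increments_le (p h a : R) (n : nat) : 0 <= p -> 0 <= h ->
  measurable (increments_le p h a n).
Proof.
move=> p0 h0; have [mw _ _ _ _] := wienerw.
apply: bigcap_measurableType => k _.
have m1 (j : nat) : measurable_fun setT (fun o => w (p + j%:R * h) o 1 0).
  by apply: mw; rewrite addr_ge0 ?mulr_ge0.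
have := measurable_funB (m1 k.+1) (m1 k).
move=> /(_ measurableT `]-oo, a]%classic (measurable_itv _)).
by rewrite setTI; congr (measurable _).
Qed.

Lemma increments_le_prob (p h a : R) (n : nat) :
  0 <= p -> 0 < h -> a <= Num.sqrt h ->
  (P (increments_le p h a n) <= ((1 - normal_tail) ^+ n)%:E)%E.
Proof.
move=> p0 h0 ah; have [mw _ _ normw indep] := wienerw.
pose t (k : nat) := p + k%:R * h.
have t0 : 0 <= t 0%N by rewrite /t mul0r addr0.
have tinc : {homo t : j k / (j < k)%N >-> j < k}.
  by move=> j k jk; rewrite /t ltrD2l ltr_pM2r// ltr_nat.
have tS k : t k.+1 - t k = h by rewrite /t -natr1; ring.
have tpos k : 0 <= t k by rewrite addr_ge0// mulr_ge0// ltW.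
(* independence is applied with no constraint on the first coordinate *)
pose B (ki : 'I_n * 'I_2) : set R :=
  if ki.2 == 1 then `]-oo, a]%classic else setT.
have mB ki : measurable (B ki).
  by rewrite /B; case: ifP => _; [exact: measurable_itv|exact: measurableT].
have := indep n t t0 tinc B mB.
pose X (ki : 'I_n * 'I_2) o := w (t ki.1.+1) o ki.2 0 - w (t ki.1) o ki.2 0.
rewrite -/X.
have -> : \bigcap_i (X i @^-1` B i) = increments_le p h a n.
  apply/seteqP; split => o /= H.
    move=> k /= kn; have := H (Ordinal kn, 1) I.
    by rewrite /B /X /= in_itv.
  move=> [k i] _ /=; rewrite /B /X /=; case: eqP => // ->.
  by rewrite /= in_itv/=; exact: (H k (ltn_ord k)).
move=> ->.
set b := normal_prob 0 (Num.sqrt h) `]-oo, a]%classic.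
have bfin : b \is a fin_num.
  by rewrite /b (fin_num_measure (normal_prob (0:R) (Num.sqrt h))).
have PX (k : 'I_n) (i : 'I_2) :
    P (X (k, i) @^-1` B (k, i)) = if i == 1 then b else 1%E.
  rewrite /B /=; case: eqP => [->|_].
    have := normw (t k) (t k.+1) (tpos k) (tinc _ _ (ltnSn k)) 1
      `]-oo, a]%classic (measurable_itv _).
    by rewrite tS -/b => <-.
  by rewrite preimage_setT probability_setT.
have -> : (\prod_ki P (X ki @^-1` B ki))%E = (\prod_(k < n) b)%E.
  transitivity (\prod_(k < n) \prod_(i < 2) P (X (k, i) @^-1` B (k, i)))%E.
    by rewrite pair_bigA; apply: eq_bigr => -[k i] _.
  apply: eq_bigr => k _.
  by rewrite !big_ord_recl big_ord0 !PX /= mule1 mul1e.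
have -> : (\prod_(k < n) b)%E = (fine b ^+ n)%:E.
  elim: {X B mB PX} n => [|n IHn]; first by rewrite big_ord0.
  by rewrite big_ord_recr/= IHn -{2}(fineK bfin) -EFinM exprSr.
have b0 : 0 <= fine b by rewrite fine_ge0// /b measure_ge0.
rewrite lee_fin lerXn2r ?nnegrE//.
  rewrite (le_trans b0)// -lee_fin fineK//; apply: normal_prob_le => //.
  by rewrite sqrtr_gt0.
by rewrite -lee_fin fineK//; apply: normal_prob_le; rewrite ?sqrtr_gt0.
Qed.

Lemma one_sided_Lipschitz_negligible (p q C : R) : 0 <= p -> p < q -> 0 <= C ->
  P.-negligible [set o | forall u v, p <= u -> u < v -> v <= q ->
    w v o 1 0 - w u o 1 0 <= C * (v - u)].
Proof.
move=> p0 pq C0.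
pose h (n : nat) := (q - p) / n.+1%:R.
have h0 n : 0 < h n by rewrite divr_gt0// subr_gt0.
pose E n := increments_le p (h n) (C * h n) n.+1.
have mE n : measurable (E n).
  by apply: measurable_increments_le => //; exact: ltW.
have mI : measurable (\bigcap_n E n) by apply: bigcap_measurable.
exists (\bigcap_n E n); split => //; last first.
  move=> o H n _ k /= kn.
  have -> : C * h n = C * (p + k.+1%:R * h n - (p + k%:R * h n)).
    by rewrite -natr1; ring.
  apply: H.
  - by rewrite lerDl mulr_ge0// ltW.
  - by rewrite ltrD2l ltr_pM2r// ltr_nat.
  - rewrite -lerBrDl /h mulrA ler_pdivrMr// [leRHS]mulrC.
    by rewrite ler_pM2r ?subr_gt0// ler_nat.
have tail1 : normal_tail <= 1.
  rewrite -lee_fin; apply: le_trans (normal_prob_window (@ltr01 R)) _.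
  exact: (probability_le1 (normal_prob (0:R) 1)).
have PE : \forall n \near \oo,
    (P (\bigcap_n E n) <= ((1 - normal_tail) ^+ n.+1)%:E)%E.
  near=> n.
  apply: (@le_trans _ _ (P (E n))).
    by apply: le_measure; rewrite ?inE//; exact: bigcap_inf.
  apply: increments_le_prob => //.
  (* C h <= sqrt h once h is small, so increments_le_prob applies *)
  have Csh : C * Num.sqrt (h n) <= 1.
    rewrite -(@ler_pXn2r _ 2)// ?nnegrE ?mulr_ge0 ?sqrtr_ge0// expr1n exprMn.
    rewrite (sqr_sqrtr (ltW (h0 n))) /h mulrA ler_pdivrMr// mul1r.
    apply: (@le_trans _ _ n%:R); last by rewrite ler_nat.
    by near: n; exact: nbhs_infty_ger.
  rewrite -{1}(sqr_sqrtr (ltW (h0 n))) expr2 mulrA.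
  by rewrite ler_piMl ?sqrtr_ge0.
have Pfin : P (\bigcap_n E n) \is a fin_num by exact: fin_num_measure.
apply/eqP; rewrite eq_le measure_ge0 andbT -(fineK Pfin) lee_fin.
have cv : (1 - normal_tail) ^+ n.+1 @[n --> \oo] --> (0 : R).
  rewrite (cvg_shiftS (fun n => (1 - normal_tail) ^+ n)).
  by apply: cvg_expr; have := normal_tail_gt0; rewrite ger0_norm; lra.
apply: (cvgr_to_ge cv); apply: filterS PE => n.
by rewrite -{1}(fineK Pfin) lee_fin.
Unshelve. all: by end_near. Qed.

Lemma wiener_one_sided_rough_ae :
  P.-negligible [set o | ~ one_sided_rough (fun s => w (Num.max 0 s) o 1 0)].
Proof.
(* rational endpoints and integer constants suffice *)
pose S (p q C : R) := [set o | forall u v, p <= u -> u < v -> v <= q ->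
    w v o 1 0 - w u o 1 0 <= C * (v - u)].
pose N (k : nat) : set Omega :=
  if unpickle k is Some (p, q, c) then
    let p : R := ratr (p : rat) in let q : R := ratr (q : rat) in
    if (0 <= p) && (p < q) then S p q (c : nat)%:R else set0
  else set0.
apply: (@negligibleS _ _ _ _ (\bigcup_k N k)); last first.
  apply: negligible_bigcup => k; rewrite /N.
  case: (unpickle k) => [[[p q] c]|]; last exact: negligible_set0.
  case: ifP => [/andP[p0 pq]|_]; last exact: negligible_set0.
  exact: one_sided_Lipschitz_negligible.
move=> o /= /existsNP[p /existsNP[q /existsNP[C]]].
move=> /not_implyP[p0 /not_implyP[pq H]].
have [p' /[!in_itv]/= /andP[pp' p'q]] := rat_in_itvoo pq.
have [q' /[!in_itv]/= /andP[p'q' q'q]] := rat_in_itvoo p'q.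
pose c := Num.bound `|C|.
exists (pickle (p', q', c)); first exact: I.
rewrite /N pickleK.
have p'0 : 0 <= ratr p' :> R by lra.
rewrite p'0 p'q' /= => u v p'u uv vq'.
rewrite leNgt; apply/negP => wuv; apply: H; exists u, v.
have u0 : 0 <= u by lra.
have v0 : 0 <= v by lra.
split; [lra|done|lra|].
rewrite !max_r//; apply: le_lt_trans wuv.
rewrite ler_pM2r ?subr_gt0//.
by rewrite (le_trans (ler_norm C))// ltW// archi_boundP.
Qed.

End wiener_rough.

(** * Failure of differentiability *)

Lemma second_difference_not_derivable (R : realType) (g : 'cV[R]_2 -> R)
    (x e : 'cV[R]_2) (c : R) :
  0 < c ->
  (forall h, 0 < h -> c * h <= g (h *: e + x) + g (- h *: e + x) - 2 * g x) ->
  ~ derivable g x e.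
Proof.
move=> c0 H /cvg_ex[/= a].
move=> /cvgrPdist_lt /(_ (c / 2)) /(_ ltac:(lra)) /nbhs_ballP[r /= r0 Hr].
have r2 : 0 < r / 2 by rewrite divr_gt0.
have rr : r / 2 < r by lra.
have q0 : r / 2 != 0 by rewrite gt_eqF.
have H1 : `|a - (r / 2)^-1 * (g (r / 2 *: e + x) - g x)| < c / 2.
  by apply: Hr => //; rewrite /ball/= sub0r normrN ger0_norm// ltW.
have H2 : `|a - (- (r / 2))^-1 * (g (- (r / 2) *: e + x) - g x)| < c / 2.
  by apply: Hr; rewrite ?oppr_eq0// /ball/= sub0r opprK ger0_norm// ltW.
have := H _ r2.
move: H1 H2; rewrite !ltr_norml => /andP[H1 _] /andP[_ H2].
set A := g (r / 2 *: e + x) in H1 *; set B := g (- (r / 2) *: e + x) in H2 *.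
move=> H3.
have : (r / 2) * ((r / 2)^-1 * (A - g x) - (- (r / 2))^-1 * (B - g x)) <
    (r / 2) * c by rewrite ltr_pM2l//; lra.
rewrite invrN mulNr opprK mulrDr !mulVKf//; lra.
Qed.

Lemma hitting_time_lt (R : realType) (f : R -> 'cV[R]_2) (t : R) :
  (hitting_time f < t%:E)%E ->
  exists s, [/\ 0 <= s, s < t & f s 1 0 = 0].
Proof.
move=> /ereal_inf_lt[_ [s [s0 fs] <-]]; rewrite lte_fin => st.
by exists s; split.
Qed.

(** The deterministic core: along a rough driving path, every open set of
    starting points reaching the boundary before t contains a point where the
    horizontal partial derivative of the first coordinate fails to exist. *)
Lemma flow_not_has_partial1 (R : realType) (w : R -> 'cV[R]_2)
    (f : R -> 'cV[R]_2 -> 'cV[R]_2) (l : 'cV[R]_2 -> cumulative R R)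
    (t : R) (V : set 'cV[R]_2) :
  {within `[0, +oo[, continuous w} -> w 0 = 0 ->
  one_sided_rough (fun s => w (Num.max 0 s) 1 0) ->
  (forall x, half_plane x ->
    reflected_solution (const_mx 1) w x (fun s => f s x) (l x)) ->
  open V -> V `&` half_plane !=set0 ->
  V `&` half_plane `<=` [set x | (hitting_time (fun s => f s x) < t%:E)%E] ->
  exists2 x, (V `&` half_plane) x & ~ has_partial1 (fun y => f t y 0 0) x.
Proof.
move=> cw w0 rough sol oV [x0 [Vx0 hx0]] hit.
have cwi i : continuous (fun s : R => w (Num.max 0 s) i 0).
  move=> s; apply: (@continuous_comp _ _ _ (fun s : R => w (Num.max 0 s))
    (fun M : 'cV[R]_2 => M i 0)); first exact: continuous_max0.
  exact: coord_continuous.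
have [e /= e0 eV] : exists2 e : R, 0 < e & ball x0 e `<=` V.
  by apply/nbhs_ballP; exact: open_nbhs_nbhs.
(* the starting points (x0_1 + a, x0_2 + b) *)
pose pt a b : 'cV[R]_2 := a *: delta_mx 0 0 + (x0 + b *: delta_mx 1 0).
have pt0 a b : pt a b 0 0 = x0 0 0 + a by rewrite !mxE/=; ring.
have pt1 a b : pt a b 1 0 = x0 1 0 + b by rewrite !mxE/=; ring.
have ptV a b : `|a| <= e / 2 -> 0 <= b -> b <= e / 2 -> V (pt a b).
  move=> ae b0 be; apply: eV; split=> // i j; rewrite ord1 /ball/=.
  rewrite !mxE/=; move: ae; rewrite ler_norml => /andP[ae1 ae2].
  by case: (unliftP 0 i) => [k|] ->; rewrite ?(ord1 k)/= ltr_norml;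
    apply/andP; split; lra.
pose b := e / 2.
have b0 : 0 < b by rewrite /b; lra.
have hpt a : half_plane (pt a b).
  by rewrite /half_plane/= pt1; move: hx0; rewrite /half_plane/=; lra.
have path a := reflected_solution_path cw (sol _ (hpt a)).
have [J0 p0 _] := path 0.
have [|T [T0 Tt fT]] := @hitting_time_lt _ (fun s => f s (pt 0 b)) t.
  by apply: hit; split; [apply: ptV; rewrite ?normr0 /b; lra|exact: hpt].
have x20 : 0 < pt 0 b 1 0.
  by rewrite pt1; move: hx0; rewrite /half_plane/=; lra.
have w20 : w (Num.max 0 0) 1 0 = 0 by rewrite max_l// w0 mxE.
have FT : f (Num.max 0 T) (pt 0 b) 1 0 <= 0 by rewrite max_r// fT.
have [s [v [delta [s0 sv vT /andP[d0 db] touch]]]] :=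
  touching_translate (cwi 0) (cwi 1) w20 rough p0 x20 b0 T0 FT.
exists (pt (- delta) b).
  by split; [apply: ptV; rewrite ?normrN ?ger0_norm// /b; lra|exact: hpt].
have coord0 a h : pt (a + h) b 0 0 = pt a b 0 0 + h by rewrite !pt0 addrA.
have coord1 a h : pt (a + h) b 1 0 = pt a b 1 0 by rewrite !pt1.
have [J p fE] := path (- delta).
have [Fs lv] : f (Num.max 0 s) (pt (- delta) b) 1 0 = 0 /\
    l (pt (- delta) b) v = 0.
  apply: (touch (fun s => f (Num.max 0 s) (pt (- delta) b) 1 0) J).
  by rewrite -coord0 -(coord1 0 (- delta)) !add0r.
apply: (@second_difference_not_derivable _ _ _ _ (exp21 s * (v - s))).
  by rewrite mulr_gt0 ?exp21_gt0// subr_gt0.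
move=> h h0.
have [Jp pp fpE] := path (- delta + h).
have [Jm pm fmE] := path (- delta - h).
have ptE a : a *: delta_mx 0 0 + pt (- delta) b = pt (- delta + a) b.
  by rewrite /pt addrA -scalerDl [a + _]addrC.
have t0 : 0 <= t by lra.
have vt : v <= t by lra.
rewrite !ptE fE// fpE// fmE// !coord0.
rewrite !coord0 !coord1 in pp pm.
have := drift_second_difference p pp pm h0 s0 sv vt Fs lv.
lra.
Qed.

Theorem theorem6 (R : realType) (d : measure_display) (Omega : measurableType d)
    (P : probability Omega R) (w : R -> Omega -> 'cV[R]_2)
    (phi : R -> 'cV[R]_2 -> Omega -> 'cV[R]_2)
    (L : 'cV[R]_2 -> Omega -> cumulative R R)
    (wienerw : wiener_process P w)
    (phiL : forall (o : Omega) (x : 'cV[R]_2), half_plane x ->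
      reflected_solution (const_mx 1) (fun t => w t o) x
        (fun t => phi t x o) (L x o))
    (t : R) (t_gt0 : 0 < t) :
  P.-negligible [set o : Omega | exists V : set 'cV[R]_2,
    [/\ open V,
        V `&` half_plane !=set0,
        V `&` half_plane `<=`
          [set x | (hitting_time (fun s => phi s x o) < t%:E)%E]
      & forall x, (V `&` half_plane) x ->
          has_partial1 (fun y => phi t y o 0 0) x]].
Proof.
apply: negligibleS (wiener_one_sided_rough_ae wienerw).
move=> o /= [V [oV Vne hit der]] rough.
have [_ w0 cw _ _] := wienerw.
have [x Vx] := @flow_not_has_partial1 _ (fun s => w s o)
  (fun s x => phi s x o) (fun x => L x o) t V (cw o) (w0 o) rough (phiL o)
  oV Vne hit.
by apply; exact: der.
Qed.
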